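(* Let $(V,\Phi,(\,,))$ be a reduced and irreducible root system with base of simple roots $\Delta\subset\Phi$, and let $\alpha\in\Delta$. The following are equivalent: (a) The fundamental weight $\eta(\alpha)$ is quasi-constant. (b) The simple root $\alpha$ is either special or co-special. (c) One has $\operatorname{dom}(\alpha)=\operatorname{dom}_{\alpha}(\alpha)$.
   Context: Setting: $V$ is a finite-dimensional $\mathbf{Q}$-vector space, $\Phi\subset V\setminus\{0\}$ is a reduced and irreducible root system with Weyl group $W=W(\Phi)$, and $(\,,)$ is a non-degenerate, $\mathbf{Q}$-valued, $W$-invariant symmetric bilinear form on $V$ that is positive definite on $V\otimes_{\mathbf{Q}}\mathbf{R}$. $\Delta\subset\Phi$ is a base of simple roots. For $\beta\in\Phi$, the coroot is $\beta^{\vee}:=2\beta/(\beta,\beta)\in V$, and $\langle v,\beta^\vee\rangle=(v,\beta^\vee)$ for $v\in V$. $\Phi^\vee=\{\beta^\vee : \beta\in\Phi\}$ is the dual root system, with base $\Delta^\vee=\{\alpha^\vee : \alpha\in\Delta\}$. Fundamental weights: $(\eta(\alpha))_{\alpha\in\Delta}$ is the basis of $V$ dual to $\Delta^{\vee}$ relative to $(\,,)$, i.e. $(\eta(\alpha),\gamma^\vee)=1$ if $\gamma=\alpha$ and $0$ if $\gamma\in\Delta\setminus\{\alpha\}$. Quasi-constant: an element $\chi\in V$ is quasi-constant if for all $\beta\in\Phi$ with $\langle\chi,\beta^\vee\rangle\neq 0$ and every $\sigma\in W$, one has $\langle\chi,\sigma\beta^\vee\rangle/\langle\chi,\beta^\vee\rangle\in\{-1,0,1\}$.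 Special and co-special: the highest root $\alpha^h$ is the unique root such that, writing each root as $\beta=\sum_{\gamma\in\Delta}m_\beta(\gamma)\gamma$, one has $m_{\alpha^h}(\gamma)\ge m_\beta(\gamma)$ for all positive roots $\beta$ and all $\gamma\in\Delta$. A simple root $\alpha\in\Delta$ is special if $m_{\alpha^h}(\alpha)=1$. It is co-special if $\alpha^\vee$ has multiplicity $1$ in the highest coroot, i.e. the coefficient of $\alpha^\vee$ is $1$ when the highest root of $\Phi^\vee$ (relative to $\Delta^\vee$) is written as a combination of $\Delta^\vee$. Levi Weyl group: for $\alpha\in\Delta$, $W_\alpha\subset W$ is the subgroup generated by the simple reflections $s_{\alpha'}$ with $\alpha'\in\Delta\setminus\{\alpha\}$. For a subset $I\subset\Delta$, $v\in V$ is $I$-dominant if $(v,\gamma)\ge 0$ for all $\gamma\in I$. For $v\in V$, $\operatorname{dom}(v)$ is the unique $\Delta$-dominant element of the $W$-orbit of $v$, and $\operatorname{dom}_\alpha(v)$ is the unique $\Delta\setminus\{\alpha\}$-dominant element of the $W_\alpha$-orbit of $v$. *)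

(* Defs.v *)
From HB Require Import structures.
From mathcomp Require Import all_boot all_order all_algebra.
From mathcomp Require Import boolp classical_sets reals.

Set Implicit Arguments.
Unset Strict Implicit.
Unset Printing Implicit Defensive.

Import Order.TTheory GRing.Theory Num.Theory.
Local Open Scope ring_scope.

(* Finite subsets of V are represented by sequences; only membership matters. *)

(* Positive definiteness on V (x)_Q R, in the R-basis induced by a Q-basis
   of V. *)
Definition posdef_real (R : realType) (V : vectType rat)
    (form : {symmetric V}) : Prop :=
  forall x : 'rV[R]_(\dim {:V}), x != 0 ->
    0 < \sum_(i < \dim {:V}) \sum_(j < \dim {:V})
          x 0 i * x 0 j * ratr (form (vbasis {:V})`_i (vbasis {:V})`_j).

Definition coroot (V : vectType rat) (form : {symmetric V}) (beta : V) : V :=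
  (2 / form beta beta) *: beta.

Definition reflection (V : vectType rat) (form : {symmetric V})
    (beta v : V) : V :=
  v - form v (coroot form beta) *: beta.

(* Reflections are involutions, so closure under inverses is automatic. *)
Inductive reflection_group (V : vectType rat) (form : {symmetric V})
    (S : seq V) : (V -> V) -> Prop :=
| reflection_group_id : reflection_group form S id
| reflection_group_refl beta :
    beta \in S -> reflection_group form S (reflection form beta)
| reflection_group_comp sigma tau :
    reflection_group form S sigma -> reflection_group form S tau ->
    reflection_group form S (sigma \o tau).

(* The last field is implied by the definition of the reflections through the
   form. *)
Record root_system (R : realType) (V : vectType rat) (form : {symmetric V})
    (Phi : seq V) : Prop := RootSystem {
  root_form_nondegenerate : nondegenerate form;
  root_form_posdef : posdef_real R form;
  root_neq0 : 0 \notin Phi;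
  root_span : <<Phi>>%VS = fullv;
  root_reflection : {in Phi &, forall beta gamma,
    reflection form beta gamma \in Phi};
  root_integral : {in Phi &, forall beta gamma,
    form gamma (coroot form beta) \is a Num.int};
  root_form_invariant : forall sigma, reflection_group form Phi sigma ->
    forall u v, form (sigma u) (sigma v) = form u v }.

Definition reduced (V : vectType rat) (Phi : seq V) : Prop :=
  forall (beta : V) (c : rat),
    beta \in Phi -> c *: beta \in Phi -> c = 1 \/ c = -1.

(* Orthogonality makes A and B disjoint, since roots are nonzero. *)
Definition irreducible (V : vectType rat) (form : {symmetric V})
    (Phi : seq V) : Prop :=
  Phi != [::] /\
  ~ exists A B : seq V, [/\ A != [::], B != [::], Phi =i A ++ B &
      {in A & B, forall a b, form a b = 0}].

(* The coefficient of gamma when beta is written in the basis Delta; it is 0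
   by convention if gamma is not in Delta. *)
Definition coeff (V : vectType rat) (Delta : seq V) (beta gamma : V) : rat :=
  if insub (index gamma Delta) is Some i then coord (in_tuple Delta) i beta
  else 0.

Record root_base (V : vectType rat) (Phi Delta : seq V) : Prop := RootBase {
  base_sub : {subset Delta <= Phi};
  base_basis : basis_of fullv Delta;
  base_integral : {in Phi & Delta, forall beta gamma,
    coeff Delta beta gamma \is a Num.int};
  base_sign : {in Phi, forall beta,
    {in Delta, forall gamma, 0 <= coeff Delta beta gamma} \/
    {in Delta, forall gamma, coeff Delta beta gamma <= 0}} }.

Definition positive_root (V : vectType rat) (Phi Delta : seq V) (beta : V) :
    Prop :=
  beta \in Phi /\ {in Delta, forall gamma, 0 <= coeff Delta beta gamma}.

(* Here and below, [xget 0 P] is the element satisfying P (0 if none does). *)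
Definition highest_root (V : vectType rat) (Phi Delta : seq V) : V :=
  xget 0 (fun h => h \in Phi /\ forall beta, positive_root Phi Delta beta ->
    {in Delta, forall gamma, coeff Delta beta gamma <= coeff Delta h gamma}).

Definition special (V : vectType rat) (Phi Delta : seq V) (alpha : V) : Prop :=
  coeff Delta (highest_root Phi Delta) alpha = 1.

Definition cospecial (V : vectType rat) (form : {symmetric V})
    (Phi Delta : seq V) (alpha : V) : Prop :=
  special (map (coroot form) Phi) (map (coroot form) Delta) (coroot form alpha).

Definition fundamental_weight (V : vectType rat) (form : {symmetric V})
    (Delta : seq V) (alpha : V) : V :=
  xget 0 (fun eta => {in Delta, forall gamma,
    form eta (coroot form gamma) = (gamma == alpha)%:R}).

Definition quasi_constant (V : vectType rat) (form : {symmetric V})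
    (Phi : seq V) (chi : V) : Prop :=
  {in Phi, forall beta, form chi (coroot form beta) != 0 ->
    forall sigma, reflection_group form Phi sigma ->
      form chi (sigma (coroot form beta)) / form chi (coroot form beta)
        \in [:: -1; 0; 1]}.

Definition dominant (V : vectType rat) (form : {symmetric V}) (I : seq V)
    (v : V) : Prop :=
  {in I, forall gamma, 0 <= form v gamma}.

(* The I-dominant element of the orbit of v under the group generated by the
   reflections in the elements of S. *)
Definition dominant_conjugate (V : vectType rat) (form : {symmetric V})
    (S I : seq V) (v : V) : V :=
  xget 0 (fun u =>
    (exists2 sigma, reflection_group form S sigma & u = sigma v) /\
    dominant form I u).

Definition dom (V : vectType rat) (form : {symmetric V}) (Phi Delta : seq V)
    (v : V) : V :=
  dominant_conjugate form Phi Delta v.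

Definition levi_dom (V : vectType rat) (form : {symmetric V}) (Delta : seq V)
    (alpha v : V) : V :=
  dominant_conjugate form (rem alpha Delta) (rem alpha Delta) v.

(* Main.v *)
From HB Require Import structures.
Require Import Defs.
From mathcomp Require Import all_boot all_order all_algebra.
From mathcomp Require Import boolp classical_sets reals.
From mathcomp Require Import ring lra zify.

(** The theorem is proved without the classification of root systems, and
    without the conjugacy of roots of equal length or the simple transitivity
    of the Weyl group on chambers.

    Let m(v) be the coefficient of alpha in v.  The form pairs the fundamental
    weight eta(alpha) with v to m(v) * (alpha, alpha) / 2, and the Weyl group
    preserves lengths, so quasi-constancy of eta(alpha) says that
    m(sigma beta) / m(beta) lies in {-1, 0, 1} for every root beta with
    m(beta) != 0 (quasi_constantP).

    (b) implies (a).  The highest root bounds all coefficients.  If alpha is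
    special, m takes only the values -1, 0, 1 on roots.  If alpha is
    co-special, the same holds for the integers
    m(beta) * (alpha, alpha) / (beta, beta), which are the coefficients of
    coroots, and their ratio at sigma beta and beta is again
    m(sigma beta) / m(beta).

    (a) implies (c).  Let mu = dom_alpha(alpha); reflections in simple roots
    other than alpha do not change m, so m(mu) = 1.  If (mu, alpha) < 0, then
    m(s_alpha mu) > 1 = m(alpha), which contradicts (a) because s_alpha mu is
    conjugate to alpha.  So mu is dominant, and a dominant root is determined
    by its length (dominant_root_inj), so that mu = dom(alpha).

    (c) implies (b).  The common value mu is a dominant root of the same length
    as alpha with m(mu) = 1.  A dominant root is the highest root or its coroot
    is the highest coroot (dominant_root_cases); alpha is special in the first
    case and co-special in the second, equality of lengths making the two kinds
    of coefficients agree.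

    Both facts on dominant roots come from one computation: if mu is a dominant
    root other than the highest root theta, then (theta, theta) is 2 or 3 times
    (mu, mu) (dominant_root_norm).  Suppose that mu is not theta and that its
    coroot is not the highest coroot, which is the coroot of a dominant root
    phi.  The computation for Phi and for the dual system makes
    (theta, theta) / (phi, phi) a product of two numbers from {2, 3}, while it
    is 1 if phi = theta and, by the computation for phi, 2 or 3 otherwise.  The
    dual system is handled by showing that the coroots form a reduced
    irreducible root system with base the simple coroots. *)

Set Implicit Arguments.
Unset Strict Implicit.
Unset Printing Implicit Defensive.

Import Order.TTheory GRing.Theory Num.Theory.
Local Open Scope ring_scope.

(** * Finite sequences of rationals *)

Lemma ex_max_seq (T : eqType) (f : T -> rat) (P : T -> Prop) (s : seq T) :
  (exists2 x, x \in s & P x) ->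
  exists x, [/\ x \in s, P x & forall y, y \in s -> P y -> f y <= f x].
Proof.
elim: s => [[x]|a s IHs exP]; first by rewrite in_nil.
have [/IHs[x [xs Px xmax]]|nexP] := pselect (exists2 x, x \in s & P x).
  have [[Pa lt_xa]|a_le] := pselect (P a /\ f x < f a).
    exists a; split=> // [|y]; first exact: mem_head.
    rewrite in_cons => /orP[/eqP-> //|ys Py].
    exact: le_trans (xmax y ys Py) (ltW lt_xa).
  exists x; split=> // [|y]; first by rewrite in_cons xs orbT.
  rewrite in_cons => /orP[/eqP-> Pa|]; last exact: xmax.
  by rewrite leNgt; apply/negP => lt_xa; apply: a_le.
case: exP => x; rewrite in_cons => /orP[/eqP->{x}|xs] Px; last first.
  by case: nexP; exists x.
exists a; split=> // [|y]; first exact: mem_head.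
by rewrite in_cons => /orP[/eqP-> //|ys Py]; case: nexP; exists y.
Qed.

Lemma sum_gt0_ex (T : eqType) (s : seq T) (F : T -> rat) :
  0 < \sum_(i <- s) F i -> exists2 i, i \in s & 0 < F i.
Proof.
move=> sum_gt0; apply: contrapT => nexF; move: sum_gt0; apply/negP.
rewrite -leNgt big_seq; apply: sumr_le0 => i si.
by rewrite leNgt; apply/negP => Fi; apply: nexF; exists i.
Qed.

(** * Coefficients with respect to a base *)

Section Coefficients.
Variables (V : vectType rat) (Delta : seq V).
Implicit Types u v w : V.

Lemma coeffB v w gamma :
  coeff Delta (v - w) gamma = coeff Delta v gamma - coeff Delta w gamma.
Proof. by rewrite /coeff; case: insub => [i|]; rewrite ?linearB ?subr0. Qed.

Lemma coeffZ c v gamma : coeff Delta (c *: v) gamma = c * coeff Delta v gamma.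
Proof. by rewrite /coeff; case: insub => [i|]; rewrite ?linearZ ?mulr0. Qed.

Lemma coeffN v gamma : coeff Delta (- v) gamma = - coeff Delta v gamma.
Proof. by rewrite -scaleN1r coeffZ mulN1r. Qed.

Lemma coeff_big (I : Type) (r : seq I) (F : I -> V) gamma :
  coeff Delta (\sum_(i <- r) F i) gamma = \sum_(i <- r) coeff Delta (F i) gamma.
Proof.
by rewrite /coeff; case: insub => [i|]; rewrite ?linear_sum ?big1_eq.
Qed.

Hypothesis basisD : basis_of fullv Delta.

Lemma coeff_base : {in Delta &, forall gamma delta,
  coeff Delta gamma delta = (gamma == delta)%:R}.
Proof.
move=> gamma delta Dg Dd; rewrite /coeff.
have sd : (index delta Delta < size Delta)%N by rewrite index_mem.
have sg : (index gamma Delta < size Delta)%N by rewrite index_mem.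
rewrite insubT /= -{1}(nth_index 0 Dg).
have := coord_free (X := in_tuple Delta) (Ordinal sg) (Ordinal sd) (basis_free basisD).
rewrite /= => ->; congr (_%:R); rewrite -val_eqE /=.
by congr nat_of_bool; apply/eqP/eqP => [|->//]; apply: index_inj.
Qed.

Lemma coeff_sum (f : V -> rat) : {in Delta, forall delta,
  coeff Delta (\sum_(gamma <- Delta) f gamma *: gamma) delta = f delta}.
Proof.
move=> delta Dd; rewrite coeff_big (bigD1_seq delta) //=; last first.
  exact/free_uniq/(basis_free basisD).
rewrite coeffZ coeff_base // eqxx mulr1 big_seq_cond big1 ?addr0 //.
by move=> g /andP[Dg /negPf ne]; rewrite coeffZ coeff_base // ne mulr0.
Qed.

Lemma coeff_sumE v : v = \sum_(gamma <- Delta) coeff Delta v gamma *: gamma.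
Proof.
have vD : v \in <<Delta>>%VS by rewrite (span_basis basisD) memvf.
have [k def_v _] := free_span (basis_free basisD) vD.
rewrite {1}def_v; apply: eq_big_seq => gamma Dg.
by rewrite def_v coeff_sum.
Qed.

Lemma coeff_eq0 v : {in Delta, forall gamma, coeff Delta v gamma = 0} -> v = 0.
Proof.
move=> v0; rewrite (coeff_sumE v) big_seq big1 // => gamma /v0->.
by rewrite scale0r.
Qed.

Lemma coeff_out v gamma : gamma \notin Delta -> coeff Delta v gamma = 0.
Proof.
by move=> Dg; rewrite /coeff insubF // index_mem; apply/negbTE.
Qed.

End Coefficients.

(** * The invariant form and coroots *)

Section Form.
Variables (V : vectType rat) (form : {symmetric V}).
Implicit Types (u v w beta gamma : V).

Lemma form_sym u v : form u v = form v u.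
Proof. by rewrite hermC expr0 mul1r. Qed.

Lemma form_subl u v w : form (u - v) w = form u w - form v w.
Proof. exact: linearBl. Qed.

Lemma form_subr u v w : form w (u - v) = form w u - form w v.
Proof. exact: linearBr. Qed.

Lemma form_scalel c u v : form (c *: u) v = c * form u v.
Proof. exact: linearZl_LR. Qed.

Lemma form_scaler c u v : form u (c *: v) = c * form u v.
Proof. exact: linearZr_LR. Qed.

Lemma form_suml (I : Type) (r : seq I) (F : I -> V) v :
  form (\sum_(i <- r) F i) v = \sum_(i <- r) form (F i) v.
Proof. exact: linear_sumlz. Qed.

Lemma form_sumr (I : Type) (r : seq I) (F : I -> V) v :
  form v (\sum_(i <- r) F i) = \sum_(i <- r) form v (F i).
Proof. exact: linear_sumr. Qed.

Lemma form_coroot v beta :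
  form v (coroot form beta) = 2 * form v beta / form beta beta.
Proof. by rewrite form_scaler; ring. Qed.

(** A rational vector is the real vector with the same coordinates. *)
Lemma posdef_rat (R : realType) :
  posdef_real R form -> forall v, v != 0 -> 0 < form v v.
Proof.
move=> posR v nz_v; pose c i := coord (vbasis {:V}) i v.
have def_v := coord_vbasis (memvf v).
pose x : 'rV[R]_(\dim {:V}) := \row_i ratr (c i).
have nz_x : x != 0.
  apply: contraNneq nz_v => /rowP x0; rewrite def_v big1 // => i _.
  have /eqP := x0 i; rewrite !mxE fmorph_eq0 => /eqP ci0.
  by rewrite -/(c i) ci0 scale0r.
have formE w : form v w = \sum_i c i * form (vbasis {:V})`_i w.
  by rewrite {1}def_v form_suml; apply: eq_bigr => i _; rewrite form_scalel.
rewrite -(ltr0q R) formE rmorph_sum; apply: lt_le_trans (posR x nz_x) _.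
apply: ler_sum => i _; rewrite form_sym formE mulr_sumr rmorph_sum.
apply: ler_sum => j _.
by rewrite form_sym !mxE !rmorphM mulrA.
Qed.

Hypothesis posf : forall v, v != 0 -> 0 < form v v.

Lemma form_ge0 v : 0 <= form v v.
Proof.
by have [->|/posf/ltW//] := eqVneq v 0; rewrite -(scale0r 0) form_scalel mul0r.
Qed.

Lemma form_le0 v : form v v <= 0 -> v = 0.
Proof. by move=> le0; apply/eqP; apply: contraTT le0 => /posf; rewrite -ltNge. Qed.

Lemma coroot_norm beta : beta != 0 ->
  form (coroot form beta) (coroot form beta) = 4 / form beta beta.
Proof.
move=> /posf/lt0r_neq0 nb; rewrite form_coroot form_scalel; field.
exact: nb.
Qed.

Lemma corootK beta : beta != 0 -> coroot form (coroot form beta) = beta.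
Proof.
move=> nz; rewrite {1}/coroot coroot_norm // /coroot scalerA.
have nb := lt0r_neq0 (posf nz).
rewrite (_ : _ * _ = 1) ?scale1r //; field; exact: nb.
Qed.

Lemma coroot_eq0 beta : beta != 0 -> coroot form beta != 0.
Proof.
move=> nz; rewrite scaler_eq0 (negPf nz) orbF mulf_neq0 // invr_neq0 //.
exact/lt0r_neq0/posf.
Qed.

Lemma reflection_coroot beta v : beta != 0 ->
  reflection form (coroot form beta) v = reflection form beta v.
Proof.
move=> nz; rewrite /reflection corootK // /coroot scalerA form_scaler.
by congr (_ - _ *: _); ring.
Qed.

End Form.

(** * Groups generated by reflections *)

Section ReflectionGroup.
Variables (V : vectType rat) (form : {symmetric V}) (S : seq V).
Implicit Types sigma : V -> V.

Lemma reflection_group_sub (S' : seq V) sigma : {subset S <= S'} ->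
  reflection_group form S sigma -> reflection_group form S' sigma.
Proof.
move=> sSS'; elim=> [|beta /sSS' S'b|s t _ IHs _ IHt].
- exact: reflection_group_id.
- exact: reflection_group_refl.
- exact: reflection_group_comp.
Qed.

Lemma reflection_groupZ sigma c v :
  reflection_group form S sigma -> sigma (c *: v) = c *: sigma v.
Proof.
move=> Ws; elim: Ws v => [|beta _|s t _ IHs _ IHt] v //=.
  by rewrite /reflection form_scalel scalerBr scalerA.
by rewrite IHt IHs.
Qed.

Lemma reflection_group_stable (P : V -> Prop) sigma v :
    (forall beta u, beta \in S -> P u -> P (reflection form beta u)) ->
  reflection_group form S sigma -> P v -> P (sigma v).
Proof.
move=> stabP Ws; elim: Ws v => [|beta Sb|s t _ IHs _ IHt] v //=.
  exact: stabP.
by move=> Pv; apply/IHs/IHt.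
Qed.

End ReflectionGroup.

(** * Roots and the simple base *)

Section RootSystem.
Variables (R : realType) (V : vectType rat) (form : {symmetric V}).
Variables (Phi Delta : seq V).
Hypothesis rootS : root_system R form Phi.
Hypothesis baseS : root_base Phi Delta.
Implicit Types (beta gamma delta mu : V).

Let posf := posdef_rat (root_form_posdef rootS).
Let basisD := base_basis baseS.
Let subD := base_sub baseS.

Lemma root_nz beta : beta \in Phi -> beta != 0.
Proof. by apply: contraTneq => ->; exact: (root_neq0 rootS). Qed.

Lemma root_gt0 beta : beta \in Phi -> 0 < form beta beta.
Proof. by move/root_nz/posf. Qed.

Lemma reflection_root beta gamma :
  beta \in Phi -> gamma \in Phi -> reflection form beta gamma \in Phi.
Proof. exact: (root_reflection rootS). Qed.

Lemma oppr_root beta : beta \in Phi -> - beta \in Phi.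
Proof.
move=> Pb; have := reflection_root Pb Pb; rewrite /reflection form_coroot.
rewrite mulfK ?lt0r_neq0 ?root_gt0 // -[X in X - _]scale1r -scalerBl.
by rewrite (_ : 1 - 2 = -1) // scaleN1r.
Qed.

Lemma reflection_isometry beta u v : beta \in Phi ->
  form (reflection form beta u) (reflection form beta v) = form u v.
Proof.
move=> Pb; apply: (root_form_invariant rootS).
exact: reflection_group_refl.
Qed.

Lemma coroot_int beta gamma : beta \in Phi -> gamma \in Phi ->
  2 * form gamma beta / form beta beta \is a Num.int.
Proof.
by move=> Pb Pg; have := root_integral rootS Pb Pg; rewrite form_coroot.
Qed.

(** If one of the two Cartan integers of beta and gamma is 1, a reflection
    gives the difference.  Otherwise both are at least 2, which bounds the
    norms of beta and gamma by (beta, gamma) and forces |beta - gamma|^2 <= 0. *)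
Lemma subr_root beta gamma : beta \in Phi -> gamma \in Phi ->
  beta != gamma -> 0 < form beta gamma -> beta - gamma \in Phi.
Proof.
move=> Pb Pg neq_bg bg_gt0.
have [bb_gt0 gg_gt0] := (root_gt0 Pb, root_gt0 Pg).
(* The integer 2 (x, y) / (y, y), if positive and not 1, is at least 2. *)
have pairing_ge2 x y : x \in Phi -> y \in Phi -> 0 < form x y ->
    2 * form x y / form y y != 1 -> form y y <= form x y.
  move=> Px Py xy_gt0 ne1; have yy_gt0 := root_gt0 Py.
  have /intrP[k def_k] := coroot_int Py Px.
  have k_gt0 : (0 < k)%R by rewrite -(ltr0z rat) -def_k divr_gt0 // mulr_gt0.
  have k_ne1 : k != 1 by apply: contraNneq ne1 => k1; rewrite def_k k1.
  have : (1 + 1 <= k)%R by rewrite lez1D lt_neqAle eq_sym k_ne1 -gtz0_ge1.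
  by rewrite -(ler_int rat) -def_k ler_pdivlMr //; lra.
have [p1|/(pairing_ge2 _ _ Pb Pg bg_gt0) le_gg] :=
  eqVneq (2 * form beta gamma / form gamma gamma) 1.
  by have := reflection_root Pg Pb; rewrite /reflection form_coroot p1 scale1r.
rewrite form_sym in bg_gt0.
have [q1|/(pairing_ge2 _ _ Pg Pb bg_gt0) le_bb] :=
  eqVneq (2 * form gamma beta / form beta beta) 1.
  have := oppr_root (reflection_root Pb Pg).
  by rewrite /reflection form_coroot q1 scale1r opprB.
have : form (beta - gamma) (beta - gamma) <= 0.
  by rewrite form_subl !form_subr [form gamma beta]form_sym in le_bb *; lra.
by move/(form_le0 posf)/eqP; rewrite subr_eq0 (negPf neq_bg).
Qed.

Lemma positive_or_opp beta : beta \in Phi ->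
  positive_root Phi Delta beta \/ positive_root Phi Delta (- beta).
Proof.
move=> Pb; have [pos|neg] := base_sign baseS Pb; [left|right]; split=> //.
  exact: oppr_root.
by move=> gamma /neg; rewrite coeffN oppr_ge0.
Qed.

Lemma positive_of_coeff beta gamma : beta \in Phi -> gamma \in Delta ->
  0 < coeff Delta beta gamma -> positive_root Phi Delta beta.
Proof.
move=> Pb Dg lt0; split=> //; have [//|/(_ _ Dg)] := base_sign baseS Pb.
by rewrite leNgt lt0.
Qed.

Lemma base_obtuse gamma delta : gamma \in Delta -> delta \in Delta ->
  gamma != delta -> form gamma delta <= 0.
Proof.
move=> Dg Dd ne_gd; rewrite leNgt; apply/negP => gd_gt0.
have /(base_sign baseS) := subr_root (subD Dg) (subD Dd) ne_gd gd_gt0.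
case=> [/(_ _ Dd)|/(_ _ Dg)]; rewrite coeffB !(coeff_base basisD) // eqxx.
  by rewrite (negPf ne_gd).
by rewrite eq_sym (negPf ne_gd).
Qed.

Lemma coeff_reflection gamma delta v : gamma \in Delta -> delta \in Delta ->
  coeff Delta (reflection form gamma v) delta
    = coeff Delta v delta
      - 2 * form v gamma / form gamma gamma * (gamma == delta)%:R.
Proof.
by move=> Dg Dd; rewrite /reflection coeffB coeffZ form_coroot (coeff_base basisD Dg).
Qed.

Definition height v := \sum_(gamma <- Delta) coeff Delta v gamma.

Lemma height_sub v w : height (v - w) = height v - height w.
Proof. by rewrite /height -sumrB; apply: eq_bigr => g _; rewrite coeffB. Qed.

Lemma height_reflection gamma v : gamma \in Delta ->
  height (reflection form gamma v)
    = height v - 2 * form v gamma / form gamma gamma.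
Proof.
move=> Dg; rewrite /reflection height_sub form_coroot; congr (_ - _).
rewrite /height; under eq_bigr do rewrite coeffZ.
rewrite -mulr_sumr (bigD1_seq gamma) ?(free_uniq (basis_free basisD)) //=.
rewrite coeff_base // eqxx big_seq_cond big1 ?addr0 ?mulr1 // => d.
by case/andP=> Dd ne_dg; rewrite coeff_base // eq_sym (negPf ne_dg).
Qed.

Lemma height_eq0 v : {in Delta, forall gamma, 0 <= coeff Delta v gamma} ->
  height v <= 0 -> v = 0.
Proof.
move=> v_ge0 le0.
have ge0 gamma : 0 <= coeff Delta v gamma.
  by have [/v_ge0//|/coeff_out->] := boolP (gamma \in Delta).
have /eqP : height v = 0 by apply/eqP; rewrite eq_le le0 sumr_ge0.
rewrite psumr_eq0 // => /allP v0.
by apply: (coeff_eq0 basisD) => gamma /v0 /eqP.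
Qed.

(** An element of maximal height is dominant, since reflecting in a simple root
    with negative pairing raises the height.  Stability of P under these raising
    reflections, instead of full invariance, allows P to be the set of roots not
    bounded by a given one, besides orbits of reflection groups. *)
Lemma exists_dominant (I : seq V) (P : V -> Prop) :
    {subset I <= Delta} -> (forall v, P v -> v \in Phi) ->
    (forall v gamma, gamma \in I -> P v -> form v gamma < 0 ->
       P (reflection form gamma v)) ->
  (exists v, P v) -> exists2 v, P v & dominant form I v.
Proof.
move=> sID sPPhi reflP [v0 Pv0].
have [|v [_ Pv vmax]] := ex_max_seq height (P := P) (s := Phi).
  by exists v0; first exact: sPPhi.
exists v => // gamma Ig; rewrite leNgt; apply/negP => vg_lt0.
have Ps := reflP v gamma Ig Pv vg_lt0.
have := vmax _ (sPPhi _ Ps) Ps; rewrite height_reflection ?sID // leNgt.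
rewrite ltrDl oppr_gt0 pmulr_llt0 ?invr_gt0 ?root_gt0 ?subD ?sID //.
by rewrite pmulr_rlt0 // vg_lt0.
Qed.

(** Otherwise (beta, beta), expanded over the base in one argument, would be a
    sum of nonpositive terms. *)
Lemma positive_acute beta : positive_root Phi Delta beta ->
  exists gamma, [/\ gamma \in Delta, 0 < coeff Delta beta gamma &
                    0 < form beta gamma].
Proof.
case=> Pb pos; have := root_gt0 Pb; rewrite {2}(coeff_sumE basisD beta).
rewrite form_sumr => /sum_gt0_ex[gamma Dg]; rewrite form_scaler => gt0.
have c_gt0 : 0 < coeff Delta beta gamma.
  by rewrite lt0r pos // andbT; apply: contraTneq gt0 => ->; rewrite mul0r ltxx.
by exists gamma; split=> //; rewrite -(pmulr_rgt0 _ c_gt0).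
Qed.

Lemma dominant_positive mu : mu \in Phi -> dominant form Delta mu ->
  positive_root Phi Delta mu.
Proof.
move=> Pm dom_mu; have [//|pos] := positive_or_opp Pm.
have [gamma [Dg _]] := positive_acute pos; rewrite -scaleN1r form_scalel.
by rewrite mulN1r oppr_gt0 ltNge dom_mu.
Qed.

(** * Irreducibility and the highest root *)

Section Irreducible.
Hypothesis irrS : irreducible form Phi.

(** An orthogonal splitting of the base splits the root system.  The point is
    that no root mixes the two parts.  A simple root gamma acute to a positive
    mixed root beta gives a lower root s_gamma beta, which is still positive
    and mixed: its coefficients in the other part are those of beta, and its
    coefficients in the part of gamma cannot all vanish because
    (s_gamma beta, gamma) = - (beta, gamma) < 0.  This contradicts the choice
    of a positive mixed root of minimal height. *)
Lemma base_indecomposable (Q : pred V) gamma0 :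
    {in Delta &, forall gamma delta, Q gamma -> ~~ Q delta ->
      form gamma delta = 0} ->
  gamma0 \in Delta -> Q gamma0 -> {in Delta, forall delta, Q delta}.
Proof.
move=> orthQ Dg0 Qg0 delta0 Dd0; apply: contrapT => /negP nQd0.
have [_ []] := irrS; pose supp (Q : pred V) beta :=
  has (fun gamma => Q gamma && (coeff Delta beta gamma != 0)) Delta.
have suppN Q' beta : supp Q' (- beta) = supp Q' beta.
  by apply: eq_has => g; rewrite coeffN oppr_eq0.
have suppCC beta : supp (predC (predC Q)) beta = supp Q beta.
  by apply: eq_has => g /=; rewrite negbK.
have step (Q' : pred V) beta gamma :
    {in Delta &, forall g d, Q' g -> ~~ Q' d -> form g d = 0} ->
    positive_root Phi Delta beta -> gamma \in Delta -> Q' gamma ->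
    0 < form beta gamma -> supp (predC Q') beta ->
    let s := reflection form gamma beta in
    [/\ positive_root Phi Delta s, supp Q' s & supp (predC Q') s].
  move=> orthQ' [Pb pos] Dg Q'g bg_gt0 supp_b s.
  have Ps : s \in Phi by exact: (reflection_root (subD Dg) Pb).
  have sE d : d \in Delta -> ~~ Q' d -> coeff Delta s d = coeff Delta beta d.
    move=> Dd nQ'd; rewrite coeff_reflection //.
    by case: eqP nQ'd => [<-|]; rewrite ?Q'g // mulr0 subr0.
  have /hasP[d Dd /andP[/= nQ'd nz_d]] := supp_b; split.
  - by apply: (positive_of_coeff Ps Dd); rewrite sE // lt0r nz_d pos.
  - apply: contraLR bg_gt0 => /hasPn supp0.
    have : form s gamma = 0.
      rewrite (coeff_sumE basisD s) form_suml big_seq big1 // => g Dg'.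
      rewrite form_scalel; have [Q'g'|nQ'g'] := boolP (Q' g).
        have := supp0 g Dg'; rewrite Q'g' /= negbK => /eqP->.
        by rewrite mul0r.
      by rewrite form_sym orthQ' ?mulr0.
    rewrite /s /reflection form_subl form_scalel form_coroot.
    have nz := lt0r_neq0 (root_gt0 (subD Dg)).
    rewrite mulfVK // => eq0; rewrite -leNgt; lra.
  - by apply/hasP; exists d; rewrite //= nQ'd sE.
have no_mixed beta : beta \in Phi -> ~ (supp Q beta /\ supp (predC Q) beta).
  move=> Pb mixed_b.
  pose mixed v := positive_root Phi Delta v /\ supp Q v /\ supp (predC Q) v.
  have [|v [_ [pos_v [sv sCv]] vmin]] :=
      ex_max_seq (fun v => - height v) (P := mixed) (s := Phi).
    have [pos|pos] := positive_or_opp Pb; first by exists beta.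
    by exists (- beta); [exact: oppr_root | rewrite /mixed !suppN].
  have [gamma [Dg _ vg_gt0]] := positive_acute pos_v.
  have mix_s : mixed (reflection form gamma v).
    have [Qg|nQg] := boolP (Q gamma).
      by have [? ? ?] := step Q v gamma orthQ pos_v Dg Qg vg_gt0 sCv.
    have [||? ? sCC] := step (predC Q) v gamma _ pos_v Dg nQg vg_gt0 _.
    - by move=> g d Dg' Dd /= nQ /negPn Q'; rewrite form_sym orthQ.
    - by rewrite suppCC.
    by rewrite /mixed -suppCC.
  have := vmin _ mix_s.1.1 mix_s; rewrite /= height_reflection // lerN2.
  by rewrite lerDl oppr_ge0 leNgt divr_gt0 ?mulr_gt0 ?(root_gt0 (subD Dg)).
exists [seq b <- Phi | ~~ supp (predC Q) b], [seq b <- Phi | ~~ supp Q b].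
have simple_supp (Q' : pred V) g : g \in Delta -> ~~ Q' g -> ~~ supp Q' g.
  move=> Dg nQ'; apply/hasPn => d Dd; rewrite coeff_base //.
  by have [<-|] := eqVneq g d; rewrite ?(negPf nQ') // eqxx andbF.
split.
- have : gamma0 \in [seq b <- Phi | ~~ supp (predC Q) b].
    by rewrite mem_filter (subD Dg0) andbT simple_supp //= Qg0.
  by apply: contraTneq => ->.
- have : delta0 \in [seq b <- Phi | ~~ supp Q b].
    by rewrite mem_filter (subD Dd0) andbT simple_supp //; apply/negP.
  by apply: contraTneq => ->.
- move=> b; rewrite mem_cat !mem_filter -andb_orl.
  have [Pb|] := boolP (b \in Phi); last by rewrite andbF.
  rewrite andbT -negb_and; symmetry; apply/negP => /andP[? ?].
  exact: (no_mixed b Pb).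
- move=> a b; rewrite !mem_filter => /andP[/hasPn nCa _] /andP[/hasPn nb _].
  rewrite (coeff_sumE basisD a) form_suml big_seq big1 // => g Dg.
  have a0 : ~~ (~~ Q g && (coeff Delta a g != 0)) := nCa g Dg.
  rewrite form_scalel; have [Qg|nQg] := boolP (Q g); last first.
    by move: a0; rewrite nQg => /negPn/eqP->; rewrite mul0r.
  rewrite (coeff_sumE basisD b) form_sumr big_seq big1 ?mulr0 // => d Dd.
  have b0 : ~~ (Q d && (coeff Delta b d != 0)) := nb d Dd.
  rewrite form_scaler; have [Qd|nQd] := boolP (Q d); last first.
    by rewrite orthQ ?mulr0.
  by move: b0; rewrite Qd => /negPn/eqP->; rewrite mul0r.
Qed.

(** A simple root outside the support of mu has nonpositive inner product with
    every simple root of the support, so dominance forces these products to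
    vanish; the support would then split off from the base. *)
Lemma dominant_full_support mu : mu \in Phi -> dominant form Delta mu ->
  {in Delta, forall gamma, 0 < coeff Delta mu gamma}.
Proof.
move=> Pm dom_mu; have pos_mu := dominant_positive Pm dom_mu.
have [_ mu_ge0] := pos_mu; have [g0 [Dg0 g0_gt0 _]] := positive_acute pos_mu.
apply: (base_indecomposable (Q := fun g => 0 < coeff Delta mu g) _ Dg0 g0_gt0).
move=> g d Dg Dd g_gt0 nd_gt0.
have d0 : coeff Delta mu d = 0 by apply/eqP; rewrite eq_le mu_ge0 // leNgt nd_gt0.
have term_le0 x : x \in Delta -> coeff Delta mu x * form x d <= 0.
  move=> Dx; have [->|ne_xd] := eqVneq x d; first by rewrite d0 mul0r.
  by rewrite mulr_ge0_le0 ?mu_ge0 ?base_obtuse.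
have := dom_mu d Dd; rewrite (coeff_sumE basisD mu) form_suml.
under eq_bigr do rewrite form_scalel.
rewrite (bigD1_seq g) ?(free_uniq (basis_free basisD)) //= => sum_ge0.
have rest_le0 : \sum_(x <- Delta | x != g) coeff Delta mu x * form x d <= 0.
  by rewrite big_seq_cond; apply: sumr_le0 => x /andP[/term_le0].
have : 0 <= coeff Delta mu g * form g d by lra.
rewrite pmulr_rge0 // => gd_ge0; apply/eqP; rewrite eq_le gd_ge0 andbT.
apply: base_obtuse => //; apply: contraTneq g_gt0 => ->.
by rewrite d0 ltxx.
Qed.

Lemma dominant_acute theta mu : theta \in Phi -> dominant form Delta theta ->
  mu \in Phi -> dominant form Delta mu -> 0 < form theta mu.
Proof.
move=> Pt dom_t Pm dom_mu; have mu_gt0 := dominant_full_support Pm dom_mu.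
have [g [Dg _ tg_gt0]] := positive_acute (dominant_positive Pt dom_t).
rewrite (coeff_sumE basisD mu) form_sumr (bigD1_seq g) //=; last first.
  exact/free_uniq/(basis_free basisD).
rewrite form_scaler ltr_pwDl ?mulr_gt0 ?mu_gt0 // big_seq_cond.
apply: sumr_ge0 => x /andP[Dx _].
by rewrite form_scaler mulr_ge0 ?dom_t // ltW ?mu_gt0.
Qed.

Let theta := highest_root Phi Delta.

(** Existence of the highest root.  A root h of maximal height is dominant.  If
    some root is not bounded by h, a highest such root mu is dominant too, as
    raising reflections keep it unbounded.  Then (h, mu) > 0, so h - mu is a
    root and has a sign: one sign bounds mu by h, and the other contradicts the
    maximal height of h. *)
Lemma highest_root_spec : theta \in Phi /\
  {in Phi & Delta, forall beta gamma,
     coeff Delta beta gamma <= coeff Delta theta gamma}.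
Proof.
pose is_highest h := h \in Phi /\ forall beta, positive_root Phi Delta beta ->
    {in Delta, forall gamma, coeff Delta beta gamma <= coeff Delta h gamma}.
suff /(xgetPex 0)[Pt tmax] : exists h, is_highest h.
  split=> // beta gamma Pb Dg; have [pos|neg] := positive_or_opp Pb.
    exact: tmax.
  have [_ /(_ _ Dg)] := neg; have := tmax _ neg _ Dg.
  by rewrite coeffN; lra.
have [irr0 _] := irrS.
have [|h [Ph _ hmax]] := ex_max_seq height (P := fun=> True) (s := Phi).
  by case: Phi irr0 => // x s _; exists x; rewrite ?mem_head.
have dom_h : dominant form Delta h.
  move=> g Dg; rewrite leNgt; apply/negP => hg_lt0.
  have := hmax _ (reflection_root (subD Dg) Ph) I.
  rewrite height_reflection // leNgt ltrDl oppr_gt0.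
  by rewrite pmulr_llt0 ?invr_gt0 ?(root_gt0 (subD Dg)) // pmulr_rlt0 // hg_lt0.
pose below v := {in Delta, forall g, coeff Delta v g <= coeff Delta h g}.
suff all_below v : v \in Phi -> below v.
  by exists h; split=> // v [/all_below].
move=> Pv; apply: contrapT => nbv.
have [||||mu [Pm nbm] dom_mu] :=
    exists_dominant (I := Delta) (P := fun v => v \in Phi /\ ~ below v).
- by [].
- by move=> ? [].
- move=> u g Dg [Pu nbu] ug_lt0; split.
    exact: (reflection_root (subD Dg) Pu).
  move=> below_s; apply: nbu => d Dd; apply: le_trans (below_s d Dd).
  rewrite coeff_reflection // lerDl oppr_ge0 mulr_le0_ge0 // pmulr_lle0.
    by rewrite pmulr_rle0 // ltW.
  by rewrite invr_gt0 (root_gt0 (subD Dg)).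
- by exists v.
have ne_hm : h != mu by apply/eqP => eq_hm; apply: nbm; rewrite -eq_hm.
have /(base_sign baseS)[hm_ge0|hm_le0] :=
    subr_root Ph Pm ne_hm (dominant_acute Ph dom_h Pm dom_mu).
  by apply: nbm => g /hm_ge0; rewrite coeffB subr_ge0.
have /eqP : mu - h = 0.
  apply: height_eq0 => [g /hm_le0|]; first by rewrite !coeffB subr_ge0 subr_le0.
  by rewrite height_sub subr_le0 hmax.
by rewrite subr_eq0 eq_sym (negPf ne_hm).
Qed.

Lemma highest_root_in : theta \in Phi.
Proof. by have [] := highest_root_spec. Qed.

Lemma coeff_le_highest beta gamma : beta \in Phi -> gamma \in Delta ->
  `|coeff Delta beta gamma| <= coeff Delta theta gamma.
Proof.
have [_ tmax] := highest_root_spec => Pb Dg.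
by rewrite ler_norml lerNl -coeffN !tmax ?oppr_root.
Qed.

Lemma highest_root_dominant : dominant form Delta theta.
Proof.
have [Pt tmax] := highest_root_spec.
move=> g Dg; rewrite leNgt; apply/negP => tg_lt0.
have := tmax _ _ (reflection_root (subD Dg) Pt) Dg.
rewrite coeff_reflection // eqxx mulr1 leNgt ltrDl oppr_gt0.
by rewrite pmulr_llt0 ?invr_gt0 ?(root_gt0 (subD Dg)) // pmulr_rlt0 // tg_lt0.
Qed.

Lemma dominant_ge0 v w : dominant form Delta v ->
  {in Delta, forall gamma, 0 <= coeff Delta w gamma} -> 0 <= form v w.
Proof.
move=> dom_v w_ge0; rewrite (coeff_sumE basisD w) form_sumr big_seq.
by apply: sumr_ge0 => g Dg; rewrite form_scaler mulr_ge0 ?dom_v ?w_ge0.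
Qed.

(** Pairing theta - mu >= 0 with theta and mu gives
    (theta, theta) >= (theta, mu) >= (mu, mu), the first inequality being
    strict for mu <> theta.  So 2 (mu, theta) / (theta, theta) is an integer
    strictly between 0 and 2, whence 2 (mu, theta) = (theta, theta), and the
    ratio p of the norms is the other Cartan integer.  It is at least 2, and
    |theta - 2 mu|^2 >= 0 gives p <= 4, with p = 4 only if theta = 2 mu. *)
Lemma dominant_root_norm mu : reduced Phi ->
    mu \in Phi -> dominant form Delta mu -> mu != theta ->
  form theta theta = 2 * form mu mu \/ form theta theta = 3 * form mu mu.
Proof.
move=> redS Pm dom_mu ne_mt; have [Pt tmax] := highest_root_spec.
have tm_ge0 : {in Delta, forall g, 0 <= coeff Delta (theta - mu) g}.
  by move=> g Dg; rewrite coeffB subr_ge0 tmax.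
have ge_tm := dominant_ge0 highest_root_dominant tm_ge0.
have := dominant_ge0 dom_mu tm_ge0; rewrite form_subr [form mu theta]form_sym.
move: ge_tm; rewrite form_subr !subr_ge0 => ge_tm ge_mm.
have [tt_gt0 mm_gt0] := (root_gt0 Pt, root_gt0 Pm).
have /intrP[q def_q] := coroot_int Pt Pm.
have /intrP[p def_p] := coroot_int Pm Pt.
have lt_tm : form theta mu < form theta theta.
  rewrite lt_neqAle ge_tm andbT; apply: contraNneq ne_mt => tmE.
  suff tm0 : theta - mu = 0 by rewrite eq_sym -subr_eq0 tm0.
  apply: (form_le0 posf).
  by rewrite form_subl !form_subr [form mu theta]form_sym; lra.
have qE : 2 * form theta mu = form theta theta.
  have q_gt0 : 0 < q%:~R :> rat.
    by rewrite -def_q form_sym divr_gt0 //; lra.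
  have q_lt2 : q%:~R < 2 :> rat.
    by rewrite -def_q form_sym ltr_pdivrMr //; lra.
  have q1 : q = 1.
    apply/eqP; rewrite eq_le -(ltzD1 q 1) -(ltr_int rat) q_lt2.
    by rewrite -gtz0_ge1 -(ltr0z rat).
  by move: def_q; rewrite q1 form_sym => /(canRL (mulfVK (lt0r_neq0 tt_gt0)));
    rewrite mul1r.
have pE : form theta theta = p%:~R * form mu mu.
  by rewrite -def_p qE mulfVK ?lt0r_neq0.
have ne_4 : form theta theta != 4 * form mu mu.
  apply/eqP => E4; have : theta - 2 *: mu = 0.
    apply: (form_le0 posf); rewrite form_subl !form_subr !form_scalel.
    by rewrite !form_scaler [form mu theta]form_sym; lra.
  move/eqP; rewrite subr_eq0 => /eqP t2m.
  have P2m : 2 *: mu \in Phi by rewrite -t2m.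
  by have [] := redS mu 2 Pm P2m.
have le_4 : form theta theta <= 4 * form mu mu.
  have := form_ge0 posf (theta - 2 *: mu).
  rewrite form_subl !form_subr !form_scalel !form_scaler.
  by rewrite [form mu theta]form_sym; lra.
have lt_4 : form theta theta < 4 * form mu mu by rewrite lt_neqAle ne_4.
have p_lt4 : (p < 4)%R.
  by rewrite -(ltr_int rat) -(ltr_pM2r mm_gt0) -pE.
have p_gt1 : (1 < p)%R.
  by rewrite -(ltr_int rat) -(ltr_pM2r mm_gt0) -pE; lra.
have : p = 2 \/ p = 3 by clear -p_lt4 p_gt1; lia.
by case=> pv; [left | right]; rewrite pE pv.
Qed.

End Irreducible.
End RootSystem.

(** * The dual root system *)

Section Dual.
Variables (R : realType) (V : vectType rat) (form : {symmetric V}).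
Variables (Phi Delta : seq V).
Hypothesis rootS : root_system R form Phi.
Hypothesis baseS : root_base Phi Delta.
Implicit Types (beta gamma delta mu : V).

Let posf := posdef_rat (root_form_posdef rootS).
Let basisD := base_basis baseS.
Let subD := base_sub baseS.
Local Notation "beta ^v" := (coroot form beta) (at level 2, format "beta ^v").
Local Notation "S ^V" := (map (coroot form) S) (at level 2, format "S ^V").

Lemma corootZ c beta : c != 0 -> beta != 0 -> (c *: beta)^v = c^-1 *: beta^v.
Proof.
move=> nz_c nz_b; have nz := lt0r_neq0 (posf nz_b).
rewrite /coroot form_scalel form_scaler !scalerA; congr (_ *: _).
by field; rewrite nz nz_c.
Qed.

Lemma coroot_reflection beta gamma : beta \in Phi -> gamma \in Phi ->
  (reflection form beta gamma)^v = reflection form beta gamma^v.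
Proof.
move=> Pb Pg; rewrite {1}/coroot (reflection_isometry rootS) //.
rewrite /reflection /coroot scalerBr scalerA; congr (_ - _ *: _).
by rewrite [in RHS]form_scalel.
Qed.

Lemma map_corootK (S : seq V) : {subset S <= Phi} -> S^V^V = S.
Proof.
move=> sSP; rewrite -map_comp -[RHS]map_id; apply/eq_in_map => b /sSP Pb /=.
by rewrite (corootK posf) // (root_nz rootS).
Qed.

Lemma coroot_inj : {in Phi &, injective (coroot form)}.
Proof.
move=> b g Pb Pg eq_v.
by rewrite -(corootK posf (root_nz rootS Pb)) eq_v (corootK posf) // (root_nz rootS).
Qed.

Lemma span_coroots (S : seq V) : {subset S <= Phi} -> <<S>>%VS = fullv ->
  <<S^V>>%VS = fullv.
Proof.
move=> sSP spanS; apply/eqP; rewrite eqEsubv subvf -spanS; apply/span_subvP => b Sb.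
rewrite -(corootK posf (root_nz rootS (sSP b Sb))) {1}/coroot memvZ //.
by apply/memv_span/map_f.
Qed.

Lemma dual_root_system : root_system R form Phi^V.
Proof.
split.
- exact: root_form_nondegenerate rootS.
- exact: root_form_posdef rootS.
- apply/mapP => -[b Pb /esym/eqP]; apply/negP.
  exact: (coroot_eq0 posf (root_nz rootS Pb)).
- by apply: span_coroots => //; apply: root_span rootS.
- move=> _ _ /mapP[b Pb ->] /mapP[g Pg ->].
  rewrite (reflection_coroot posf) ?(root_nz rootS) // -coroot_reflection //.
  by apply/map_f; apply: (reflection_root rootS).
- move=> _ _ /mapP[b Pb ->] /mapP[g Pg ->].
  rewrite (corootK posf) ?(root_nz rootS) // form_sym.
  exact: (root_integral rootS).
- move=> s; elim=> [//|_ /mapP[b Pb ->]|s1 s2 _ IH1 _ IH2] u v /=.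
    rewrite !(reflection_coroot posf) ?(root_nz rootS) //.
    exact: (reflection_isometry rootS).
  by rewrite IH1 IH2.
Qed.

Lemma dual_reduced : reduced Phi -> reduced Phi^V.
Proof.
move=> redS _ c /mapP[b Pb ->] /mapP[g Pg eq_g].
have nz_b := root_nz rootS Pb; have nz_g := root_nz rootS Pg.
have nz_c : c != 0.
  apply: contraNneq (coroot_eq0 posf nz_g) => c0.
  by rewrite -eq_g c0 scale0r.
have : c^-1 *: b \in Phi.
  rewrite -{1}(corootK posf nz_b) -corootZ ?(coroot_eq0 posf) //.
  by rewrite eq_g (corootK posf).
case/(redS b _ Pb) => /(congr1 GRing.inv); rewrite invrK ?invr1 ?invrN1; by [left|right].
Qed.

Lemma dual_irreducible : irreducible form Phi -> irreducible form Phi^V.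
Proof.
case=> nzP irrP; split; first by case: Phi nzP.
case=> A [B [nzA nzB eqAB orthAB]]; apply: irrP; exists A^V, B^V; split.
- by case: A nzA {eqAB orthAB}.
- by case: B nzB {eqAB orthAB}.
- rewrite -map_cat => x; rewrite -{1}(map_corootK (S := Phi)) //.
  exact: (eq_mem_map _ eqAB).
- move=> _ _ /mapP[a Aa ->] /mapP[b Bb ->].
  by rewrite form_scalel form_scaler (orthAB a b) ?mulr0.
Qed.

Lemma dual_basis : basis_of fullv Delta^V.
Proof.
have spanD := span_basis basisD.
rewrite basisEdim (span_coroots subD spanD) subvv size_map.
by rewrite (size_basis (X := in_tuple Delta) basisD) /=.
Qed.

Lemma coeff_dual v gamma : gamma \in Delta ->
  coeff Delta^V v gamma^v = coeff Delta v gamma * (form gamma gamma / 2).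
Proof.
move=> Dg; rewrite {1}(coeff_sumE basisD v) coeff_big.
have coeffE d : d \in Delta ->
    coeff Delta^V (coeff Delta v d *: d) gamma^v
      = (coeff Delta v d * (form d d / 2)) * (d == gamma)%:R.
  move=> Dd; rewrite coeffZ -mulrA; congr (_ * _).
  have nz := lt0r_neq0 (root_gt0 rootS (subD Dd)).
  have -> : (d == gamma) = (d^v == gamma^v).
    by apply/eqP/eqP => [->//|]; apply: coroot_inj; apply: subD.
  rewrite -(coeff_base dual_basis) ?map_f // -coeffZ scalerA.
  by rewrite (_ : _ * _ = 1) ?scale1r //; field.
rewrite big_seq (eq_bigr _ (fun d => coeffE d)) -big_seq.
rewrite (bigD1_seq gamma) ?(free_uniq (basis_free basisD)) //= eqxx mulr1.
by rewrite big1 ?addr0 // => d /negPf->; rewrite mulr0.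
Qed.

Lemma coeff_coroot beta gamma : gamma \in Delta ->
  coeff Delta^V beta^v gamma^v
    = coeff Delta beta gamma * form gamma gamma / form beta beta.
Proof.
move=> Dg; rewrite coeff_dual // coeffZ.
by move: (form beta beta)^-1 => c; field.
Qed.

(** Induction on the height of a positive root u: for a simple root g acute to
    u, the coroot of s_g u differs from that of u by an integral multiple of
    the coroot of g.  If s_g u is negative, u is a multiple of g, hence equal
    to g as the system is reduced. *)
Lemma coroot_integral : reduced Phi -> {in Phi & Delta, forall beta gamma,
  coeff Delta^V beta^v gamma^v \is a Num.int}.
Proof.
move=> redS beta gamma Pb Dg.
pose int_root v := {in Delta, forall g, coeff Delta^V v^v g^v \is a Num.int}.
suff pos_int v : positive_root Phi Delta v -> int_root v.
  have [/pos_int/(_ _ Dg)//|/pos_int/(_ _ Dg)] := positive_or_opp rootS baseS Pb.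
  rewrite -scaleN1r corootZ ?(root_nz rootS Pb) ?oppr_eq0 ?oner_eq0 //.
  by rewrite invrN1 scaleN1r coeffN rpredN.
move=> pos_v; apply: contrapT => non_int.
have [|u [_ [[Pu u_ge0] non_int_u] umin]] := ex_max_seq (fun v => - height Delta v)
    (P := fun v => positive_root Phi Delta v /\ ~ int_root v) (s := Phi).
  by exists v => //; case: pos_v.
have [g [Dg' cu_gt0 ug_gt0]] := positive_acute rootS baseS (conj Pu u_ge0).
pose s := reflection form g u; have nz_g := root_nz rootS (subD Dg').
have Ps : s \in Phi by apply: (reflection_root rootS (subD Dg')).
have [pos_s|[_ neg_s]] := positive_or_opp rootS baseS Ps.
  have int_s : int_root s.
    apply: contrapT => non_int_s.
    have := umin s Ps (conj pos_s non_int_s).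
    rewrite (height_reflection form baseS) // lerN2 lerDl oppr_ge0 leNgt.
    by rewrite divr_gt0 ?mulr_gt0 ?(root_gt0 rootS (subD Dg')).
  apply: non_int_u => d Dd; have := int_s d Dd.
  rewrite /s (coroot_reflection (subD Dg') Pu) -(reflection_coroot posf) ?nz_g //.
  rewrite /reflection coeffB [X in _ - X]coeffZ (corootK posf nz_g).
  rewrite (coeff_base dual_basis (map_f _ Dg') (map_f _ Dd)) => int_s'.
  rewrite -[X in X \is a _](subrK (form u^v g * (g^v == d^v)%:R)).
  rewrite rpredD // rpredM ?rpred_nat // form_sym.
  exact: (root_integral rootS Pu (subD Dg')).
have u_g d : d \in Delta -> d != g -> coeff Delta u d = 0.
  move=> Dd ne_dg; apply/eqP; rewrite eq_le u_ge0 // andbT.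
  have := neg_s d Dd; rewrite coeffN (coeff_reflection form baseS) // eq_sym.
  by rewrite (negPf ne_dg) mulr0 subr0 oppr_ge0.
have def_u : u = coeff Delta u g *: g.
  rewrite {1}(coeff_sumE basisD u) (bigD1_seq g) //=; last first.
    exact/free_uniq/(basis_free basisD).
  rewrite big_seq_cond big1 ?addr0 // => d /andP[Dd ne_dg].
  by rewrite u_g // scale0r.
have Pcg : coeff Delta u g *: g \in Phi by rewrite -def_u.
have [u1|u1] := redS g _ (subD Dg') Pcg; last by move: cu_gt0; rewrite u1.
apply: non_int_u => d Dd; rewrite def_u u1 scale1r.
by rewrite (coeff_base dual_basis) ?map_f // rpred_nat.
Qed.

Lemma dual_root_base : reduced Phi -> root_base Phi^V Delta^V.
Proof.
move=> redS; split.
- by move=> _ /mapP[g Dg ->]; rewrite map_f ?subD.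
- exact: dual_basis.
- move=> _ _ /mapP[b Pb ->] /mapP[g Dg ->]; exact: coroot_integral.
- move=> _ /mapP[b Pb ->].
  have bb_gt0 := root_gt0 rootS Pb.
  case: (base_sign baseS Pb) => sgn; [left|right] => _ /mapP[g Dg ->];
    have gg_gt0 := root_gt0 rootS (subD Dg); rewrite coeff_coroot //.
    by rewrite divr_ge0 ?mulr_ge0 ?sgn // ltW.
  by rewrite -mulrA mulr_le0_ge0 ?sgn // divr_ge0 ?ltW.
Qed.

Lemma dominant_coroot mu : mu \in Phi -> dominant form Delta mu ->
  dominant form Delta^V mu^v.
Proof.
move=> Pm dom_mu _ /mapP[g Dg ->]; rewrite form_scalel form_scaler.
have [gg_gt0 mm_gt0] := (root_gt0 rootS (subD Dg), root_gt0 rootS Pm).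
have [c_gt0 d_gt0] := (divr_gt0 (ltr0n rat 2) gg_gt0, divr_gt0 (ltr0n rat 2) mm_gt0).
apply: mulr_ge0; first exact: ltW.
by apply: mulr_ge0; [exact: ltW | exact: dom_mu].
Qed.

End Dual.

(** * Classification of dominant roots *)

Section DominantRoots.
Variables (R : realType) (V : vectType rat) (form : {symmetric V}).
Variables (Phi Delta : seq V).
Hypothesis rootS : root_system R form Phi.
Hypothesis redS : reduced Phi.
Hypothesis irrS : irreducible form Phi.
Hypothesis baseS : root_base Phi Delta.

Let posf := posdef_rat (root_form_posdef rootS).
Let rootSv := dual_root_system rootS.
Let redSv := dual_reduced rootS redS.
Let irrSv := dual_irreducible rootS irrS.
Let baseSv := dual_root_base rootS baseS redS.
Local Notation "beta ^v" := (coroot form beta) (at level 2, format "beta ^v").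
Local Notation "S ^V" := (map (coroot form) S) (at level 2, format "S ^V").

(** Otherwise mu is strictly between theta and phi in length, where theta is
    the highest root and phi the root whose coroot is the highest coroot, with norm ratios 2 or 3 on both sides; theta and phi
    would have norm ratio 4, 6 or 9, while it must be 1, 2 or 3. *)
Lemma dominant_root_cases mu : mu \in Phi -> dominant form Delta mu ->
  mu = highest_root Phi Delta \/ mu^v = highest_root Phi^V Delta^V.
Proof.
move=> Pm dom_mu; set theta := highest_root _ _; set psi := highest_root _ _.
have [->|ne_mt] := eqVneq mu theta; first by left.
have [->|ne_mp] := eqVneq mu^v psi; first by right.
have dom_t : dominant form Delta theta := highest_root_dominant rootS baseS irrS.
have Pt : theta \in Phi := highest_root_in rootS baseS irrS.
have /mapP[phi Pp def_psi] : psi \in Phi^V := highest_root_in rootSv baseSv irrSv.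
have dom_p : dominant form Delta phi.
  have := highest_root_dominant rootSv baseSv irrSv.
  move/(dominant_coroot rootSv baseSv (highest_root_in rootSv baseSv irrSv)).
  rewrite -/psi def_psi (corootK posf (root_nz rootS Pp)).
  by rewrite (map_corootK rootS (base_sub baseS)).
have tm := dominant_root_norm rootS baseS irrS redS Pm dom_mu ne_mt.
have dom_mv := dominant_coroot rootS baseS Pm dom_mu.
have := dominant_root_norm rootSv baseSv irrSv redSv (map_f _ Pm) dom_mv ne_mp.
have mm_gt0 := root_gt0 rootS Pm; have pp_gt0 := root_gt0 rootS Pp.
rewrite -/psi def_psi !(coroot_norm posf) ?(root_nz rootS) // => mp.
have {}mp : form mu mu = 2 * form phi phi \/ form mu mu = 3 * form phi phi.
  have [nm np] := (lt0r_neq0 mm_gt0, lt0r_neq0 pp_gt0).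
  have inv_eq k : 4 / form phi phi = k * (4 / form mu mu) ->
      form mu mu = k * form phi phi.
    move=> E; transitivity (form mu mu * (4 / form phi phi) * form phi phi / 4).
      by field.
    by rewrite E; field.
  by case: mp => /inv_eq; [left|right].
have [eq_pt|ne_pt] := eqVneq phi theta.
  by rewrite eq_pt in pp_gt0 mp; exfalso; clear def_psi eq_pt; lra.
have tp := dominant_root_norm rootS baseS irrS redS Pp dom_p ne_pt.
by exfalso; clear def_psi; lra.
Qed.

Lemma dominant_root_inj mu nu :
    mu \in Phi -> dominant form Delta mu -> nu \in Phi -> dominant form Delta nu ->
  form mu mu = form nu nu -> mu = nu.
Proof.
move=> Pm dom_m Pn dom_n eq_mn.
have mm_gt0 := root_gt0 rootS Pm.
have theta_norm x : x \in Phi -> dominant form Delta x ->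
    form x x = form (highest_root Phi Delta) (highest_root Phi Delta) ->
    x = highest_root Phi Delta.
  move=> Px dom_x; have [//|ne E] := eqVneq x (highest_root Phi Delta).
  have := dominant_root_norm rootS baseS irrS redS Px dom_x ne.
  have := root_gt0 rootS Px => xx_gt0 norm_t; exfalso; lra.
have [m_t|m_p] := dominant_root_cases Pm dom_m.
  by rewrite [RHS]theta_norm -?eq_mn ?m_t.
have [n_t|n_p] := dominant_root_cases Pn dom_n.
  by rewrite [LHS]theta_norm ?eq_mn ?n_t.
by apply: (coroot_inj rootS) => //; rewrite m_p n_p.
Qed.

End DominantRoots.


(** * The three conditions on a simple root *)

Lemma int_ratio (x y : rat) : x \is a Num.int -> y \is a Num.int ->
  `|x| <= 1 -> `|y| <= 1 -> y != 0 -> x / y \in [:: -1; 0; 1].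
Proof.
move=> /intrP[m ->] /intrP[n ->]; rewrite -!intr_norm !(ler_int _ _ 1) intr_eq0.
move=> m_le1 n_le1 nz_n.
have [->|->] : n = 1 \/ n = -1 by lia.
all: by have [->|[->|->]] : m = 1 \/ m = 0 \/ m = -1 by lia.
Qed.

Section SimpleRoot.
Variables (R : realType) (V : vectType rat) (form : {symmetric V}).
Variables (Phi Delta : seq V) (alpha : V).
Hypothesis rootS : root_system R form Phi.
Hypothesis redS : reduced Phi.
Hypothesis irrS : irreducible form Phi.
Hypothesis baseS : root_base Phi Delta.
Hypothesis Da : alpha \in Delta.

Let posf := posdef_rat (root_form_posdef rootS).
Let basisD := base_basis baseS.
Let subD := base_sub baseS.
Let Pa := subD Da.
Let aa_gt0 := root_gt0 rootS Pa.
Let rootSv := dual_root_system rootS.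
Let irrSv := dual_irreducible rootS irrS.
Let baseSv := dual_root_base rootS baseS redS.
Local Notation "beta ^v" := (coroot form beta) (at level 2, format "beta ^v").
Local Notation "S ^V" := (map (coroot form) S) (at level 2, format "S ^V").
Local Notation eta := (fundamental_weight form Delta alpha).
Local Notation m_alpha beta := (coeff Delta beta alpha).
Local Notation W := (reflection_group form Phi).

(** The map sending v to the sum of (v, gamma^v) gamma over the base is
    injective by positivity of the form, hence bijective; the fundamental
    weight is the preimage of alpha. *)
Lemma fundamental_weight_pairing :
  {in Delta, forall gamma, form eta gamma^v = (gamma == alpha)%:R}.
Proof.
apply: (xgetPex 0 (P := fun eta => {in Delta, forall gamma,
  form eta gamma^v = (gamma == alpha)%:R})).
pose T v := \sum_(g <- Delta) form v g^v *: g.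
have linT : linear T.
  move=> c u v; rewrite /T scaler_sumr -big_split /=; apply: eq_bigr => g _.
  by rewrite linearPl scalerDl scalerA.
pose lT := GRing.isLinear.Build _ _ _ _ T linT.
pose T' : {linear V -> V} := HB.pack T lT.
have TE v : linfun T' v = T v by rewrite lfunE.
have coeffT v g : g \in Delta -> coeff Delta (T v) g = form v g^v.
  exact: (coeff_sum basisD (fun g => form v g^v)).
have kerT : lker (linfun T') == 0%VS.
  rewrite -subv0; apply/subvP => v; rewrite memv_ker TE memv0 => /eqP Tv0.
  suff : form v v <= 0 by move/(form_le0 posf)->.
  rewrite {2}(coeff_sumE basisD v) form_sumr big_seq big1 // => g Dg.
  have := coeffT v g Dg; rewrite Tv0 -(scale0r g) coeffZ mul0r form_coroot.
  move/esym/eqP; rewrite mulf_eq0 invr_eq0 mulf_eq0 /=.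
  rewrite (negPf (lt0r_neq0 (root_gt0 rootS (subD Dg)))) orbF => /eqP vg0.
  by rewrite form_scaler vg0 mulr0.
exists ((linfun T')^-1%VF alpha) => g Dg.
by rewrite -coeffT // -TE lker0_lfunVK // (coeff_base basisD Da Dg) eq_sym.
Qed.

Lemma form_fundamental_weight v :
  form eta v = m_alpha v * (form alpha alpha / 2).
Proof.
rewrite {1}(coeff_sumE basisD v) form_sumr (bigD1_seq alpha) //=; last first.
  exact/free_uniq/(basis_free basisD).
have pair g : g \in Delta -> form eta g = (g == alpha)%:R * (form g g / 2).
  move=> Dg; rewrite -fundamental_weight_pairing // form_coroot.
  by field; rewrite lt0r_neq0 ?(root_gt0 rootS (subD Dg)).
rewrite form_scaler pair // eqxx mul1r big_seq_cond big1 ?addr0 //.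
by move=> g /andP[Dg /negPf ne]; rewrite form_scaler pair // ne mul0r mulr0.
Qed.

Lemma quasi_constantP : quasi_constant form Phi eta <->
  {in Phi, forall beta sigma, W sigma -> m_alpha beta != 0 ->
     m_alpha (sigma beta) / m_alpha beta \in [:: -1; 0; 1]}.
Proof.
have ratioE sigma beta : W sigma -> beta \in Phi -> m_alpha beta != 0 ->
    form eta (sigma beta^v) / form eta beta^v
      = m_alpha (sigma beta) / m_alpha beta.
  move=> Ws Pb nz_b; rewrite /coroot (reflection_groupZ _ _ Ws) !form_scaler.
  rewrite !form_fundamental_weight; field.
  have nb := lt0r_neq0 (root_gt0 rootS Pb); have na := lt0r_neq0 aa_gt0.
  by apply/and3P.
have nzE beta : beta \in Phi -> (form eta beta^v != 0) = (m_alpha beta != 0).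
  move=> Pb; have nb := lt0r_neq0 (root_gt0 rootS Pb).
  have -> : form eta beta^v = m_alpha beta * (form alpha alpha / form beta beta).
    by rewrite form_coroot form_fundamental_weight; field.
  by rewrite mulf_eq0 mulf_eq0 invr_eq0 (negPf nb) (gt_eqF aa_gt0) !orbF.
split=> [qc beta Pb sigma Ws nz_b | qc beta Pb + sigma Ws].
  by rewrite -ratioE //; apply: qc; rewrite ?nzE.
by rewrite nzE // => nz_b; rewrite ratioE //; apply: qc.
Qed.

Lemma reflection_group_root sigma beta : W sigma -> beta \in Phi ->
  sigma beta \in Phi.
Proof.
move=> Ws; apply: (reflection_group_stable (P := fun v => v \in Phi) _ Ws).
by move=> g u Pg Pu; apply: (reflection_root rootS).
Qed.

(** The ratio of coefficients at two conjugate roots is the same for the roots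
    and for their coroots, so it suffices that one of the two families takes
    values in {-1, 0, 1}. *)
Lemma special_quasi_constant :
    special Phi Delta alpha \/ cospecial form Phi Delta alpha ->
  quasi_constant form Phi eta.
Proof.
case=> [sp|cosp]; apply/quasi_constantP => beta Pb sigma Ws nz_b;
  have Psb := reflection_group_root Ws Pb.
  have le1 b : b \in Phi -> `|m_alpha b| <= 1.
    by move=> Pb'; rewrite -sp (coeff_le_highest rootS baseS irrS).
  by apply: int_ratio; rewrite ?le1 ?(base_integral baseS).
pose n b := coeff Delta^V b^v alpha^v.
have le1 b : b \in Phi -> `|n b| <= 1.
  by move=> Pb'; rewrite -cosp (coeff_le_highest rootSv baseSv irrSv) ?map_f.
have nb := lt0r_neq0 (root_gt0 rootS Pb); have na := lt0r_neq0 aa_gt0.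
have nE b : n b = m_alpha b * form alpha alpha / form b b.
  exact: (coeff_coroot rootS baseS).
have <- : n (sigma beta) / n beta = m_alpha (sigma beta) / m_alpha beta.
  rewrite !nE (root_form_invariant rootS) //; field.
  by rewrite nz_b na nb.
apply: int_ratio; rewrite ?le1 ?(coroot_integral rootS baseS) //.
by rewrite nE !mulf_neq0 ?invr_neq0.
Qed.

Lemma dom_spec : let mu := dom form Phi Delta alpha in
  [/\ mu \in Phi, dominant form Delta mu & form mu mu = form alpha alpha].
Proof.
move=> mu.
have [[sigma Ws def_mu] dom_mu] : (exists2 sigma, W sigma & mu = sigma alpha) /\
    dominant form Delta mu.
  apply: (xgetPex 0 (P := fun u => (exists2 s, W s & u = s alpha) /\
    dominant form Delta u)).
  have [||||u orb dom_u] := exists_dominant rootS baseS (I := Delta)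
      (P := fun u => exists2 s, W s & u = s alpha).
  - by [].
  - by move=> _ [s Ws ->]; apply: reflection_group_root.
  - move=> _ g Dg [s Ws ->] _; exists (reflection form g \o s) => //.
    by apply: reflection_group_comp => //; apply/reflection_group_refl/subD.
  - by exists alpha, id => //; apply: reflection_group_id.
  - by exists u.
by split; rewrite // def_mu ?reflection_group_root // (root_form_invariant rootS).
Qed.

Lemma levi_dom_spec : let mu := levi_dom form Delta alpha alpha in
  [/\ exists2 sigma, W sigma & mu = sigma alpha,
      {in Delta, forall gamma, gamma != alpha -> 0 <= form mu gamma} &
      m_alpha mu = 1].
Proof.
move=> mu; pose I := rem alpha Delta; pose WI := reflection_group form I.
have sID : {subset I <= Delta} by move=> g /mem_rem.
have sWI sigma : WI sigma -> W sigma.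
  by apply: reflection_group_sub => g /sID/subD.
have uniqD : uniq Delta := free_uniq (basis_free basisD).
have [[sigma Ws def_mu] dom_mu] : (exists2 sigma, WI sigma & mu = sigma alpha) /\
    dominant form I mu.
  apply: (xgetPex 0 (P := fun u => (exists2 s, WI s & u = s alpha) /\
    dominant form I u)).
  have [||||u orb dom_u] := exists_dominant rootS baseS (I := I)
      (P := fun u => exists2 s, WI s & u = s alpha).
  - by [].
  - by move=> _ [s /sWI Ws ->]; apply: reflection_group_root.
  - move=> _ g Ig [s Ws ->] _; exists (reflection form g \o s) => //.
    by apply: reflection_group_comp => //; apply: reflection_group_refl.
  - by exists alpha, id => //; apply: reflection_group_id.
  - by exists u.
split.
- by exists sigma => //; apply: sWI.
- by move=> g Dg ne_ga; apply: dom_mu; rewrite mem_rem_uniq // !inE ne_ga.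
rewrite def_mu.
apply: (reflection_group_stable (P := fun v => m_alpha v = 1) _ Ws).
  move=> g u; rewrite mem_rem_uniq // !inE => /andP[/negPf ne_ga Dg] u1.
  by rewrite (coeff_reflection form baseS) // ne_ga mulr0 subr0.
by rewrite (coeff_base basisD) // eqxx.
Qed.

(** It suffices that the Levi-dominant conjugate of alpha pairs nonnegatively
    with alpha; otherwise its reflection in alpha is a conjugate of alpha in
    which alpha has coefficient larger than 1. *)
Lemma quasi_constant_dom : quasi_constant form Phi eta ->
  dom form Phi Delta alpha = levi_dom form Delta alpha alpha.
Proof.
move/quasi_constantP => qc.
have [Pm dom_m mm] := dom_spec.
have [[sigma Ws def_mu] dom_mu mu1] := levi_dom_spec.
set mu := levi_dom _ _ _ _ in def_mu dom_mu mu1 *.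
have Pmu : mu \in Phi by rewrite def_mu reflection_group_root.
apply: (dominant_root_inj rootS redS irrS baseS) => //; last first.
  by rewrite mm def_mu (root_form_invariant rootS).
move=> g Dg; have [->{g Dg}|] := eqVneq g alpha; last exact: dom_mu.
rewrite leNgt; apply/negP => ma_lt0.
have a1 : m_alpha alpha = 1 by rewrite (coeff_base basisD) // eqxx.
have Wsa : W (reflection form alpha \o sigma).
  by apply: reflection_group_comp => //; apply: reflection_group_refl.
have := qc alpha Pa _ Wsa; rewrite a1 oner_eq0 divr1 /= -def_mu => /(_ isT).
rewrite (coeff_reflection form baseS) // eqxx mulr1 mu1.
have : 2 * form mu alpha / form alpha alpha < 0.
  by rewrite pmulr_llt0 ?invr_gt0 // pmulr_rlt0.
move: (_ / _) => k k_lt0; rewrite !inE => /or3P[] /eqP; lra.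
Qed.

(** Let mu be the common value.  The coefficient of alpha^v in the coroot of mu
    is that of alpha in mu times (alpha, alpha) / (mu, mu), and mu is conjugate
    to alpha. *)
Lemma dom_special : dom form Phi Delta alpha = levi_dom form Delta alpha alpha ->
  special Phi Delta alpha \/ cospecial form Phi Delta alpha.
Proof.
move=> eq_dom; have [Pm dom_m mm] := dom_spec; have [_ _] := levi_dom_spec.
rewrite -eq_dom => m1.
have [m_t|m_p] := dominant_root_cases rootS redS irrS baseS Pm dom_m.
  by left; rewrite /special -m_t.
right; rewrite /cospecial /special -m_p (coeff_coroot rootS baseS) //.
by rewrite m1 mm mul1r divff ?lt0r_neq0.
Qed.

End SimpleRoot.

Theorem theorem1p5 (R : realType) (V : vectType rat) (form : {symmetric V})
    (Phi Delta : seq V) (alpha : V) :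
  root_system R form Phi -> reduced Phi -> irreducible form Phi ->
  root_base Phi Delta -> alpha \in Delta ->
  [/\ quasi_constant form Phi (fundamental_weight form Delta alpha) <->
        special Phi Delta alpha \/ cospecial form Phi Delta alpha,
      special Phi Delta alpha \/ cospecial form Phi Delta alpha <->
        dom form Phi Delta alpha = levi_dom form Delta alpha alpha &
      quasi_constant form Phi (fundamental_weight form Delta alpha) <->
        dom form Phi Delta alpha = levi_dom form Delta alpha alpha].
Proof.
move=> rootS redS irrS baseS Da.
have ba := special_quasi_constant rootS redS irrS baseS Da.
have ac := quasi_constant_dom rootS redS irrS baseS Da.
have cb := dom_special rootS redS irrS baseS Da.
by split; split; auto.
Qed.
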